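(* The starting position of Proper $2$-coloring on a path is an $\mathcal{N}$-position if the path has odd length and a $\mathcal{P}$-position if the path has even length.
   Context: The length of a path is its number of vertices. Proper $2$-coloring on a graph: two players alternate; a move chooses one uncolored vertex and assigns it one of two colors so that no two adjacent vertices have the same color. Both players may use both colors. Colored vertices are never recolored. The player unable to move loses. The starting position is the one with all vertices uncolored. A position is a $\mathcal{P}$-position if the second player (the one not about to move) has a winning strategy, and an $\mathcal{N}$-position otherwise. *)

(* Defs.v *)
From mathcomp Require Import all_boot.

Set Implicit Arguments.
Unset Strict Implicit.
Unset Printing Implicit Defensive.

Section ProperTwoColoring.

Variables (T : finType) (e : rel T).

(* The two colors are [true] and [false]; [None] means uncolored. *)
Definition position := {ffun T -> option bool}.

Definition start : position := [ffun => None].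

Definition proper (p : position) : bool :=
  [forall u, forall v, (e u v && (p u != None)) ==> (p u != p v)].

Definition set_color (p : position) (v : T) (c : bool) : position :=
  [ffun u => if u == v then Some c else p u].

Definition move : rel position := fun p q =>
  [exists v, exists c,
    [&& p v == None, q == set_color p v c & proper q]].

Definition terminal (p : position) : bool := [forall q, ~~ move p q].

(* A play from [p] is a sequence [h] with [path move p h]: its item [i] is the
   position after move [i], counted from 0, so the player about to move at [p]
   makes the moves of even index and the second player those of odd index.  A
   strategy maps the positions met so far, in chronological order, to the next
   position. *)
Definition strategy := seq position -> position.

Definition second_follows (s : strategy) (p : position) (h : seq position) :
    Prop :=
  forall i, i < size h -> odd i -> nth p h i = s (p :: take i h).

(* The first clause says that [s] prescribes a legal move whenever the second
   player has one; the second that every finished play following [s] ends with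
   the first player unable to move.  There are no infinite plays, since each
   move colors an uncolored vertex. *)
Definition second_wins_with (s : strategy) (p : position) : Prop :=
  (forall h, path move p h -> second_follows s p h -> odd (size h) ->
     ~~ terminal (last p h) -> move (last p h) (s (p :: h))) /\
  (forall h, path move p h -> second_follows s p h ->
     terminal (last p h) -> ~~ odd (size h)).

Definition P_position (p : position) : Prop :=
  exists s : strategy, second_wins_with s p.

Definition N_position (p : position) : Prop := ~ P_position p.

End ProperTwoColoring.

Definition path_adj (n : nat) : rel 'I_n :=
  fun i j => (i.+1 == j :> nat) || (j.+1 == i :> nat).

(* Main.v *)
Require Import Defs.
From mathcomp Require Import all_boot.
From mathcomp Require Import zify.

(** The winner copies the opponent's moves in the mirror that exchanges the two
    ends of the path.

    For an even number of vertices the mirror fixes no vertex, and the second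
    player answers a move at a vertex by giving the mirror vertex the opposite
    color.  The only two adjacent vertices that mirror each other are the middle
    ones, and they get opposite colors, so the answer is always legal.

    For an odd number of vertices the first player colors the middle vertex and
    from then on copies with the same color.  No vertex is now adjacent to its
    mirror image, since the two are at even distance, so copying is again legal.

    Both cases are instances of a single statement about a graph with an
    involutive automorphism, [mirror_answerable]: the set of symmetric positions
    can be restored after every move of the opponent.  The lemmas
    [answerable_P_position] and [move_to_answerable_N_position] turn such a set
    of positions into the outcome of the game. *)

Set Implicit Arguments.
Unset Strict Implicit.
Unset Printing Implicit Defensive.

Section Answering.

Variables (T : finType) (e : rel T).
Implicit Types (p q r : position T) (h : seq (position T)) (I : pred (position T)).

Definition answerable I : Prop :=
  forall p q, I p -> move e p q -> exists2 r, move e q r & I r.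

Lemma second_follows_rcons (s : strategy T) p h q :
  second_follows s p (rcons h q) <->
  second_follows s p h /\ (odd (size h) -> q = s (p :: h)).
Proof.
split=> [fol | [fol qE] i].
  split=> [i lti oddi | oddh].
    have := fol i; rewrite size_rcons nth_rcons lti -cats1 takel_cat 1?ltnW //.
    by apply=> //; apply: ltnW.
  have := fol (size h); rewrite size_rcons nth_rcons ltnn eqxx.
  by rewrite -cats1 take_size_cat //; apply.
rewrite size_rcons ltnS leq_eqVlt nth_rcons -cats1 => /orP[/eqP-> | lti] oddi.
  by rewrite ltnn eqxx take_size_cat // qE.
by rewrite lti takel_cat 1?ltnW // fol.
Qed.

(** The second player always moves back into [I], so that after an even number
    of moves the play is in [I], and after an odd number a legal answer exists:
    no play can end there. *)
Lemma answerable_P_position I p : answerable I -> I p -> P_position e p.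
Proof.
move=> ansI Ip.
pose s : strategy T := fun ps =>
  odflt p [pick r | move e (last p ps) r && I r].
have sP h : (exists2 r, move e (last p h) r & I r) ->
    move e (last p h) (s (p :: h)) /\ I (s (p :: h)).
  move=> [r mr Ir]; rewrite /s /=.
  by case: pickP => [r' /andP[] // | /(_ r)]; rewrite mr Ir.
have inv h : path (move e) p h -> second_follows s p h ->
    if odd (size h) then exists2 r, move e (last p h) r & I r
    else I (last p h).
  elim/last_ind: h => [|h q IHh] //.
  rewrite rcons_path => /andP[ph mq] /second_follows_rcons[fol qE].
  have := IHh ph fol; rewrite size_rcons last_rcons /=.
  case: ifP qE => /= [_ -> // /sP[] // | _ _ Ih].
  exact: ansI Ih mq.
exists s; split=> h ph fol.
  by move=> oddh _; have := inv h ph fol; rewrite oddh => /sP[].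
move=> /forallP term; apply/negP => oddh.
have := inv h ph fol; rewrite oddh => -[r mr _].
by have := term r; rewrite mr.
Qed.

Lemma move_card p q : move e p q ->
  #|[pred u | q u == None]| < #|[pred u | p u == None]|.
Proof.
case/existsP=> v /existsP[c] /and3P[/eqP pv /eqP-> _].
apply: proper_card; apply/properP; split.
  by apply/subsetP=> u; rewrite !inE ffunE; case: (u == v).
by exists v; rewrite inE ?ffunE ?eqxx ?pv.
Qed.

(** A winning strategy of the second player would lose the play in which the
    first player enters [I] and then keeps restoring it: uncolored vertices run
    out, so this play ends, and it can only end in [I], with the second player
    to move. *)
Lemma move_to_answerable_N_position I p q :
  answerable I -> move e p q -> I q -> N_position e p.
Proof.
move=> ansI mpq Iq [s [legal final]].
suff noplay k h : #|[pred u | last p h u == None]| < k -> path (move e) p h ->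
    second_follows s p h -> odd (size h) -> ~ I (last p h).
  by apply: (noplay _ [:: q] (ltnSn _)) => //=; [rewrite mpq | case].
elim: k h => // k IHk h ltk ph fol oddh Ih.
case: (boolP (terminal e (last p h))) => [/(final h ph fol) | nterm].
  by rewrite oddh.
have m1 := legal h ph fol oddh nterm.
have [r m2 Ir] := ansI _ _ Ih m1.
apply: (IHk (rcons (rcons h (s (p :: h))) r)).
- rewrite last_rcons; have := move_card m1; have := move_card m2; lia.
- by rewrite !rcons_path last_rcons ph m1 m2.
- apply/second_follows_rcons; split; first by apply/second_follows_rcons.
  by rewrite size_rcons /= oddh.
- by rewrite !size_rcons /= negbK.
- by rewrite last_rcons.
Qed.

End Answering.

Section Mirror.

Variables (T : finType) (e : rel T) (f : T -> T) (b : bool).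

(** The Boolean [b] tells whether the mirror exchanges the two colors.  A vertex
    on the mirror cannot be copied, which is why it must be colored already. *)
Definition mirrored (p : position T) : bool :=
  [forall u, (p (f u) == omap (addb b) (p u)) && ((f u == u) ==> (p u != None))].

(** A move at [v] is answered at [f v]. The only edges between the two newly
    colored vertices join [v] and [f v], and the hypothesis on [b] makes their
    colors differ. Any other edge avoids [f v], and was properly colored before
    the answer, or avoids [v], and is then the reflection of an edge that avoids
    [f v]. *)
Lemma mirror_answerable :
  involutive f -> {mono f : u v / e u v} -> (forall v, e v (f v) -> b) ->
  answerable e mirrored.
Proof.
move=> fK fe eb p q /forallP mirp /existsP[v /existsP[c]].
case/and3P=> /eqP pv /eqP qE /forallP propq.
have pf u : p (f u) = omap (addb b) (p u) by case/andP: (mirp u) => /eqP.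
have fvv : f v != v.
  by case/andP: (mirp v) => _; rewrite pv /=; case: (f v == v).
have vfv : v != f v by rewrite eq_sym.
have eqfv u : (f u == v) = (u == f v) by rewrite -(inj_eq (inv_inj fK)) fK.
pose r := set_color q (f v) (b (+) c).
have rf u : r (f u) = omap (addb b) (r u).
  rewrite /r qE !ffunE (inj_eq (inv_inj fK)) eqfv.
  case: (eqVneq u v) => [-> | _]; first by rewrite (negPf vfv).
  by case: (u == f v); rewrite /= ?addKb.
have away u w : e u w -> r u != None -> u != f v -> w != f v -> r u != r w.
  rewrite /r => euw; rewrite !ffunE => + /negPf uE /negPf wE.
  by rewrite uE wE => qu; have /forallP/(_ w) := propq u; rewrite euw qu.
have twins : e v (f v) -> r v != r (f v).
  move=> /eb bT; rewrite /r qE !ffunE !eqxx (negPf vfv) bT.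
  by case: (c).
exists r; last first.
  apply/forallP=> u; rewrite rf eqxx /=; apply/implyP=> /eqP fu.
  case/andP: (mirp u) => _; rewrite fu eqxx /= /r qE !ffunE.
  by case: (u == f v); case: (u == v).
apply/existsP; exists (f v); apply/existsP; exists (b (+) c).
apply/and3P; split=> //.
  by rewrite qE ffunE (negPf fvv) pf pv.
apply/forallP=> u; apply/forallP=> w; apply/implyP=> /andP[euw ru].
have [/andP[u1 w1] | ] := boolP ((u != f v) && (w != f v)); first exact: away.
have [/andP[u1 w1] _ | ] := boolP ((u != v) && (w != v)).
  (* The reflected edge avoids [f v], and [r] is symmetric by [rf]. *)
  have : r (f u) != r (f w).
    apply: away; rewrite ?fe ?(inj_eq (inv_inj fK)) // rf.
    by case: (r u) ru.
  by rewrite !rf; apply: contraNN => /eqP->.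
rewrite !negb_and !negbK => /orP[]/eqP E1 /orP[]/eqP E2.
- by rewrite -E2 E1 eqxx in fvv.
- by move: euw; rewrite E1 E2.
- by move: euw; rewrite E1 E2 -{2}[v]fK fe eq_sym.
- by rewrite -E2 E1 eqxx in fvv.
Qed.

End Mirror.

Lemma path_adj_rev n : {mono @rev_ord n : i j / path_adj i j}.
Proof. by move=> i j; rewrite /path_adj /=; have := ltn_ord i; have := ltn_ord j; lia. Qed.

Lemma path_adj_rev_ord n (i : 'I_n) : path_adj i (rev_ord i) -> ~~ odd n.
Proof. by rewrite /path_adj /=; have := ltn_ord i; lia. Qed.

Theorem corollary4 (n : nat) :
  (odd n -> N_position (@path_adj n) (start 'I_n)) /\
  (~~ odd n -> P_position (@path_adj n) (start 'I_n)).
Proof.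
split=> parn.
  have ans : answerable (@path_adj n) (mirrored (@rev_ord n) false).
    apply: mirror_answerable; [exact: rev_ordK | exact: path_adj_rev |].
    by move=> v /path_adj_rev_ord; rewrite parn.
  have ltm : n./2 < n by lia.
  pose m := Ordinal ltm.
  have revm u : (rev_ord u == m) = (u == m).
    by rewrite -!val_eqE /=; have := ltn_ord u; lia.
  apply: (move_to_answerable_N_position (q := set_color (start _) m true) ans).
    apply/existsP; exists m; apply/existsP; exists true.
    rewrite ffunE !eqxx /=; apply/forallP=> u; apply/forallP=> v.
    rewrite !ffunE; apply/implyP=> /andP[].
    case: (eqVneq u m) => // ->; case: (eqVneq v m) => // ->.
    by rewrite /path_adj; lia.
  apply/forallP=> u; rewrite !ffunE revm.
  case: (eqVneq u m) => [-> | num] //=; first by rewrite implybT.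
  by rewrite implybF; move: num; rewrite -!val_eqE /=; have := ltn_ord u; lia.
apply: (answerable_P_position (I := mirrored (@rev_ord n) true)).
  by apply: mirror_answerable; [exact: rev_ordK | exact: path_adj_rev |].
apply/forallP=> u; rewrite !ffunE /= implybF.
by rewrite -val_eqE /=; have := ltn_ord u; lia.
Qed.
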